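(* Let $\Gamma\in\mathbb{K}^{d_1\times\cdots\times d_\ell}$ be an $\ell$-tensor with modes $U_1,\ldots,U_\ell$, let $\mathcal{C}$ be an $\ell$-chisel (an $m\times\ell$ matrix over $\mathbb{K}$), and let $\delta=(\delta_1,\ldots,\delta_\ell)\in\mathbb{K}^{k_1}\times\cdots\times\mathbb{K}^{k_\ell}$ for positive integers $k_1,\ldots,k_\ell$. Suppose we have direct sum decompositions $U_a=X_{a1}\oplus\cdots\oplus X_{ak_a}$ ($1\leq a\leq\ell$) of the modes that exhibit the sparsity pattern $\Delta(\mathcal{C},\delta)$ for $\Gamma$. For each $a\in\{1,\ldots,\ell\}$, let $D_a:U_a\to U_a$ be the linear operator with $\delta_a(i)$-eigenspaces $X_{ai}$, i.e. the operator satisfying $D_a x=\delta_a(i)\,x$ for all $x\in X_{ai}$ and all $i\in\{1,\ldots,k_a\}$. Then $D=(D_1,\ldots,D_\ell)$ is a $\mathcal{C}$-derivation of $\Gamma$.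
   Context: $\mathbb{K}$ is a field and $[k]=\{1,\ldots,k\}$. An $\ell$-tensor is an array $\Gamma\in\mathbb{K}^{d_1\times\cdots\times d_\ell}$, with modes $U_a=\mathbb{K}^{d_a}$ for $a\in[\ell]$, interpreted as the multilinear form $U_1\times\cdots\times U_\ell\to\mathbb{K}$ given by $$\langle\Gamma\mid u_1,\ldots,u_\ell\rangle=\sum_{i_1\in[d_1]}\cdots\sum_{i_\ell\in[d_\ell]}\Gamma_{i_1\cdots i_\ell}\,u_{1i_1}\cdots u_{\ell i_\ell}.$$ For subspaces $Y_a\leq U_a$, $\langle\Gamma\mid Y_1,\ldots,Y_\ell\rangle$ denotes the span of all values $\langle\Gamma\mid y_1,\ldots,y_\ell\rangle$ with $y_a\in Y_a$. Decompositions $U_a=X_{a1}\oplus\cdots\oplus X_{ak_a}$ ($a\in[\ell]$) exhibit a set $\Delta\subseteq\prod_{a}[k_a]$ as a sparsity pattern for $\Gamma$ if $$(i_1,\ldots,i_\ell)\notin\Delta\ \Longrightarrow\ \langle\Gamma\mid X_{1i_1},\ldots,X_{\ell i_\ell}\rangle=0.$$ An $\ell$-chisel is an $m\times\ell$ matrix $\mathcal{C}$ with entries $\mathcal{C}_{ja}\in\mathbb{K}$. For $\delta=(\delta_1,\ldots,\delta_\ell)\in\mathbb{K}^{k_1}\times\cdots\times\mathbb{K}^{k_\ell}$, writing $\delta_a(i)$ for the $i$-th entry of $\delta_a$, $$\Delta(\mathcal{C},\delta)=\Big\{(i_1,\ldots,i_\ell)\in\prod_{a=1}^{\ell}[k_a]\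 :\ \forall j\in[m],\ \sum_{a=1}^{\ell}\mathcal{C}_{ja}\,\delta_a(i_a)=0\Big\}.$$ A tuple $(D_1,\ldots,D_\ell)$ of linear operators $D_a:U_a\to U_a$ is a $\mathcal{C}$-derivation of $\Gamma$ if for every $j\in[m]$ and all $(u_1,\ldots,u_\ell)\in U_1\times\cdots\times U_\ell$, $$\sum_{a=1}^{\ell}\mathcal{C}_{ja}\,\langle\Gamma\mid u_1,\ldots,u_{a-1},D_au_a,u_{a+1},\ldots,u_\ell\rangle=0.$$ *)

(* Defs.v *)
From HB Require Import structures.
From mathcomp Require Import all_boot all_order all_algebra.

Set Implicit Arguments.
Unset Strict Implicit.
Unset Printing Implicit Defensive.

Import GRing.Theory.
Local Open Scope ring_scope.

(* The elements of [n_1] x ... x [n_l]. *)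
Definition multi_index (l : nat) (n : 'I_l -> nat) : finType :=
  {dffun forall a : 'I_l, 'I_(n a)}.

Section Tensors.
Variables (K : fieldType) (l : nat) (d : 'I_l -> nat).

Definition tensor : Type := {ffun multi_index d -> K}.

Definition mode (a : 'I_l) : vectType K := 'rV[K]_(d a).

Definition multilinear_form (Gamma : tensor) (u : forall a, mode a) : K :=
  \sum_(i : multi_index d) Gamma i * \prod_(a < l) u a 0 (i a).

(* Membership in <Gamma | Y_1, ..., Y_l>, a linear subspace of K. *)
Definition in_span_values (Gamma : tensor) (Y : forall a, {vspace (mode a)})
    (c : K) : Prop :=
  exists (n : nat) (s : 'I_n -> K) (y : 'I_n -> forall a, mode a),
    (forall t a, y t a \in Y a) /\
    c = \sum_(t < n) s t * multilinear_form Gamma (y t).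

Definition span_values_eq0 (Gamma : tensor) (Y : forall a, {vspace (mode a)}) :
    Prop :=
  forall c : K, in_span_values Gamma Y c <-> c = 0.

Definition direct_decomposition (vT : vectType K) (n : nat)
    (X : 'I_n -> {vspace vT}) : Prop :=
  (\sum_(i < n) X i)%VS = fullv /\ directv (\sum_(i < n) X i)%VS.

Definition exhibits_sparsity (k : 'I_l -> nat) (Gamma : tensor)
    (X : forall a, 'I_(k a) -> {vspace (mode a)})
    (Delta : {set multi_index k}) : Prop :=
  forall i : multi_index k, i \notin Delta ->
    span_values_eq0 Gamma (fun a => X a (i a)).

(* dfwith u (D a (u a)) is u with its a-th entry replaced by D_a u_a. *)
Definition derivation (m : nat) (C : 'M[K]_(m, l)) (Gamma : tensor)
    (D : forall a, 'End(mode a)) : Prop :=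
  forall (j : 'I_m) (u : forall a, mode a),
    \sum_(a < l) C j a * multilinear_form Gamma (dfwith u (D a (u a))) = 0.

End Tensors.

Definition chisel_pattern (K : fieldType) (l m : nat) (C : 'M[K]_(m, l))
    (k : 'I_l -> nat) (delta : forall a : 'I_l, 'rV[K]_(k a)) :
    {set multi_index k} :=
  [set i : multi_index k |
    [forall j : 'I_m, \sum_(a < l) C j a * delta a 0 (i a) == 0]].

(* Main.v *)
Require Import Defs.
From mathcomp Require Import all_boot all_order all_algebra.

Set Implicit Arguments.
Unset Strict Implicit.
Unset Printing Implicit Defensive.

Import GRing.Theory.
Local Open Scope ring_scope.

(** Split each [u a] as a sum of vectors [x a i] of [X a i]. By multilinearity
    the value of the tensor at [u] is the sum, over all multi-indices [i], of
    the values [g i] at the tuples [x a (i a)]. Since [D a] scales [x a (i a)]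
    by [delta a 0 (i a)], replacing [u a] by [D a (u a)] multiplies the term
    [g i] by that scalar. The [j]-th derivation expression is therefore the sum
    over [i] of [(\sum_a C j a * delta a 0 (i a)) * g i]. When [i] lies in the
    pattern the first factor vanishes, by definition of the pattern; when it
    does not, [g i] vanishes, by sparsity. *)

(** The indices of the inner sums have types that depend on the outer index,
    so they are first gathered in one sigma type, where the non-dependent
    distributivity law applies. *)
Lemma bigA_distr_dffun (R : comPzSemiRingType) (I : finType) (J : I -> finType)
    (F : forall a, J a -> R) :
  \prod_a \sum_(i : J a) F a i =
  \sum_(i : {dffun forall a, J a}) \prod_a F a (i a).
Proof.
pose P a := [ffun i => F a i].
transitivity (\prod_a \sum_(t in tagged_with J a) untag 0 (P a) t).
  apply: eq_bigr => a _.
  rewrite [RHS]big_sub (reindex (tag_with a)) /=; last exact/onW_bij/tag_with_bij.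
  by apply: eq_bigr => i _; rewrite (@untagE _ _ _ _ _ _ (Tagged J i) erefl) ffunE.
rewrite bigA_distr_big_dep -big_fprod.
rewrite (reindex (@fprod_of_dffun I J)) /=; last first.
  exact/onW_bij/fprod_of_dffun_bij.
apply: eq_bigr => i _; apply: eq_bigr => a _.
by rewrite ffunE fprodE.
Qed.

Section Multilinearity.
Variables (K : fieldType) (l : nat) (d : 'I_l -> nat) (Gamma : tensor K d).

Lemma multilinear_form_ext (u v : forall a, mode K d a) :
  (forall a, u a = v a) -> multilinear_form Gamma u = multilinear_form Gamma v.
Proof.
by move=> uv; apply: eq_bigr => i _; congr (_ * _); apply: eq_bigr => a _; rewrite uv.
Qed.

Lemma multilinear_form_sum (k : 'I_l -> nat)
    (x : forall a, 'I_(k a) -> mode K d a) :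
  multilinear_form Gamma (fun a => \sum_i x a i) =
  \sum_(i : multi_index k) multilinear_form Gamma (fun a => x a (i a)).
Proof.
rewrite [RHS]exchange_big; apply: eq_bigr => p _ /=.
rewrite -mulr_sumr; congr (_ * _).
rewrite -(bigA_distr_dffun (fun a i => x a i 0 (p a))).
by apply: eq_bigr => a _; rewrite summxE.
Qed.

Lemma multilinear_form_scale (c : 'I_l -> K) (u : forall a, mode K d a) :
  multilinear_form Gamma (fun a => c a *: u a) =
  (\prod_a c a) * multilinear_form Gamma u.
Proof.
rewrite mulr_sumr; apply: eq_bigr => p _.
rewrite mulrCA -big_split /=; congr (_ * _).
by apply: eq_bigr => a _; rewrite mxE.
Qed.

Lemma span_values_eq0_form (Y : forall a, {vspace (mode K d a)})
    (y : forall a, mode K d a) :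
  span_values_eq0 Gamma Y -> (forall a, y a \in Y a) ->
  multilinear_form Gamma y = 0.
Proof.
move=> Y0 Yy; apply/Y0; exists 1, (fun=> 1), (fun=> y).
by split=> //; rewrite big_ord1 mul1r.
Qed.

End Multilinearity.

(** Replacing the [b]-th entry of [u] scales every term of the expansion of [u]
    along the [x a i]: the [b]-th factor contributes its eigenvalue and the
    others contribute [1], which is what the coefficients [c] record. *)
Lemma multilinear_form_eigen (K : fieldType) (l : nat) (d : 'I_l -> nat)
    (Gamma : tensor K d) (k : 'I_l -> nat)
    (x : forall a, 'I_(k a) -> mode K d a) (delta : forall a, 'rV[K]_(k a))
    (D : forall a, 'End(mode K d a)) (u : forall a, mode K d a) (b : 'I_l) :
    (forall a i, D a (x a i) = delta a 0 i *: x a i) ->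
    (forall a, u a = \sum_i x a i) ->
  multilinear_form Gamma (dfwith u (D b (u b))) =
  \sum_(i : multi_index k)
    delta b 0 (i b) * multilinear_form Gamma (fun a => x a (i a)).
Proof.
move=> eigD ux; pose c a (i : 'I_(k a)) := if a == b then delta a 0 i else 1.
transitivity (multilinear_form Gamma (fun a => \sum_i c a i *: x a i)).
  apply: multilinear_form_ext => a; rewrite /c.
  case: dfwithP => [|a' ba'].
    by rewrite eqxx ux linear_sum; apply: eq_bigr => i _ /=; rewrite eigD.
  by rewrite eq_sym (negPf ba') ux; apply: eq_bigr => i _; rewrite scale1r.
rewrite multilinear_form_sum; apply: eq_bigr => i _.
rewrite (multilinear_form_scale Gamma (fun a => c a (i a))); congr (_ * _).
by rewrite -big_mkcond big_pred1_eq.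
Qed.

Theorem theorem5p4 (K : fieldType) (l : nat) (d : 'I_l -> nat)
    (Gamma : tensor K d) (m : nat) (C : 'M[K]_(m, l))
    (k : 'I_l -> nat) (k_gt0 : forall a : 'I_l, (0 < k a)%N)
    (delta : forall a : 'I_l, 'rV[K]_(k a))
    (X : forall a : 'I_l, 'I_(k a) -> {vspace (mode K d a)})
    (decX : forall a : 'I_l, direct_decomposition (X a))
    (sparseX : exhibits_sparsity Gamma X (chisel_pattern C delta))
    (D : forall a : 'I_l, 'End(mode K d a))
    (eigD : forall (a : 'I_l) (i : 'I_(k a)) (x : mode K d a),
        x \in X a i -> D a x = delta a 0 i *: x) :
  derivation C Gamma D.
Proof.
move=> j u.
pose x a i := sumv_pi (\sum_(i < k a) X a i)%VS i (u a).
have Xx a i : x a i \in X a i by exact: memv_sum_pi.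
have ux a : u a = \sum_i x a i.
  by rewrite /x sumv_pi_sum // (decX a).1 memvf.
have eigx a i : D a (x a i) = delta a 0 i *: x a i by exact/eigD/Xx.
under eq_bigr => a _ do
  rewrite (multilinear_form_eigen _ _ eigx ux) mulr_sumr.
rewrite exchange_big big1 //= => i _.
under eq_bigr do rewrite mulrA.
rewrite -mulr_suml.
have [|/sparseX X0] := boolP (i \in chisel_pattern C delta).
  by rewrite inE => /forallP/(_ j)/eqP->; rewrite mul0r.
by rewrite (span_values_eq0_form X0 (fun a => Xx a (i a))) mulr0.
Qed.
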